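(* Let $\mathbf{p}$ be a parametric curve on $[0,1]$ whose coordinates are real polynomials of degree at most $n$, and let $(q_k)_{k=1}^M$ be the degree $m$ implicit Bernstein basis, forming a partition of unity, so that $\sum_{k=1}^M q_k(\mathbf{p}(t))=1$ for all $t\in[0,1]$. Let $\alpha,\beta>-1$, let $L=mn+1$, and let $(P_j)_{j=1}^L$ be the Jacobi polynomial basis on $[0,1]$ with parameters $\alpha,\beta$, normalized so that $\|P_j\|_\infty=1$ for $j=1,\dots,L$. Let $\mathbf{D}_P=(d_{j,k})\in\mathbb{R}^{L\times M}$ be the matrix determined by $q_k(\mathbf{p}(t))=\sum_{j=1}^L d_{j,k}P_j(t)$ for $k=1,\dots,M$. Then $$\sum_{k=1}^M d_{j,k}=\begin{cases}1,& j=1,\\ 0,& 2\le j\le L.\end{cases}$$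
   Context: The Bernstein basis of degree $m$ is $q_{\mathbf{k}}(u,v,w)=\binom{m}{k_1,k_2,k_3}u^{k_1}v^{k_2}w^{k_3}$ with $k_1+k_2+k_3=m$, ordered lexicographically as $q_1,\dots,q_M$, $M=\binom{m+2}{2}$. Here $(u,v,w)$ are barycentric coordinates with respect to a triangle (so $u+v+w=1$), and $\mathbf{p}(t)$ is the triple of coordinates of the curve point, so that the basis is a partition of unity. Each $q_k\circ\mathbf{p}$ is a polynomial of degree at most $mn$. The Jacobi polynomial basis on $[0,1]$ with parameters $\alpha,\beta>-1$ is the family of polynomials $P_1,P_2,\dots$, with $P_j$ of degree exactly $j-1$, orthogonal with respect to $\int_0^1 t^\alpha(1-t)^\beta f(t)g(t)\,dt$; $\|\cdot\|_\infty$ is the maximum norm on $[0,1]$. The normalization is a positive rescaling of the standard Jacobi polynomials, so that the constant polynomial is $P_1\equiv 1$. *)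

(* Defs.v *)
From mathcomp Require Import all_boot all_order all_algebra.
From mathcomp Require Import all_classical all_reals all_analysis.

Set Implicit Arguments.
Unset Strict Implicit.
Unset Printing Implicit Defensive.

Import Order.TTheory GRing.Theory Num.Theory.
Import numFieldNormedType.Exports.

Local Open Scope classical_set_scope.
Local Open Scope ring_scope.

(* The exponents (k1, k2, k3) with k1 + k2 + k3 = m, in increasing
   lexicographic order. *)
Definition bernstein_exponents (m : nat) : seq (nat * nat * nat) :=
  [seq (k1, k2, m - k1 - k2)%N | k1 <- iota 0 m.+1, k2 <- iota 0 (m - k1).+1].

Lemma size_bernstein_exponents (m : nat) :
  size (bernstein_exponents m) = 'C(m + 2, 2).
Proof.
rewrite /bernstein_exponents size_allpairs_dep sumnE big_map.
under eq_bigr do rewrite size_iota.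
rewrite -[iota 0 m.+1]/(index_iota 0 m.+1) big_nat_rev /= addn2.
rewrite -bin2_sum [RHS]big_nat_recl // add0n.
by apply: eq_big_nat => i /andP[_]; rewrite ltnS => im; rewrite subSS subKn.
Qed.

Lemma mem_bernstein_exponents (m k1 k2 k3 : nat) :
  ((k1, k2, k3) \in bernstein_exponents m) = (k1 + k2 + k3 == m)%N.
Proof.
apply/allpairsPdep/eqP => [[a [b [+ + [-> -> ->]]]]|<-].
  rewrite !mem_iota !add0n !ltnS /= => am bm.
  by rewrite -addnA (subnKC bm) subnKC.
exists k1, k2; rewrite !mem_iota !add0n !ltnS /= -addnA leq_addr.
by rewrite !addKn leq_addr.
Qed.

(* The k-th (counting from 0) Bernstein polynomial of degree m, as a function
   of the triple x = (u, v, w). *)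
Definition bernstein (R : realType) (m : nat) (k : 'I_('C(m + 2, 2)))
    (x : 'I_3 -> R) : R :=
  let: (k1, k2, k3) := nth (0, 0, 0)%N (bernstein_exponents m) k in
  m`!%:R / (k1`! * k2`! * k3`!)%:R
    * x 0 ^+ k1 * x 1 ^+ k2 * x 2%:R ^+ k3.

Definition jacobi_dot (R : realType) (alpha beta : R) (f g : {poly R}) : R :=
  \int[lebesgue_measure]_(t in `[0, 1])
    (t `^ alpha * (1 - t) `^ beta * f.[t] * g.[t]).

Definition maxnorm01 (R : realType) (f : {poly R}) : R :=
  sup [set `|f.[t]| | t in `[0, 1]].

(* P i, with i counted from 0, has degree i.  Degrees and orthogonality
   determine each P i up to a nonzero factor, and the norm fixes that factor
   up to sign.  The standard Jacobi polynomials on [-1, 1] are positive at 1,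
   so their positive multiples, transported to [0, 1], are all positive at the
   image of 1; this is the endpoint 1 under x = 2t - 1 and the endpoint 0
   under x = 1 - 2t.  Both conventions are allowed. *)
Definition normalized_jacobi_basis (R : realType) (alpha beta : R) (L : nat)
    (P : 'I_L -> {poly R}) : Prop :=
  [/\ forall i, size (P i) = i.+1,
      forall i j, i != j -> jacobi_dot alpha beta (P i) (P j) = 0,
      forall i, maxnorm01 (P i) = 1
    & (forall i, 0 < (P i).[1]) \/ (forall i, 0 < (P i).[0])].

(* Main.v *)
(* By the multinomial theorem the Bernstein basis sums to (u + v + w)^m = 1, so
   summing the expansions over k yields the constant polynomial 1 = P_1 as a
   combination of the P_j.  The P_j have pairwise distinct degrees, hence this
   combination is the trivial one. *)

Require Import Defs.
From mathcomp Require Import all_boot all_order all_algebra.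
From mathcomp Require Import all_classical all_reals all_analysis.
From mathcomp Require Import ring.

Set Implicit Arguments.
Unset Strict Implicit.
Unset Printing Implicit Defensive.

Import Order.TTheory GRing.Theory Num.Theory.
Import numFieldNormedType.Exports.

Local Open Scope classical_set_scope.
Local Open Scope ring_scope.

(** The trinomial theorem as two nested binomial expansions, which follow the nested enumeration in
    [bernstein_exponents]. *)
Lemma sum_bernstein (R : realType) (m : nat) (x : 'I_3 -> R) :
  \sum_(k < 'C(m + 2, 2)) bernstein k x = (\sum_(i < 3) x i) ^+ m.
Proof.
pose F (e : nat * nat * nat) : R := let: (k1, k2, k3) := e in
  m`!%:R / (k1`! * k2`! * k3`!)%:R * x 0 ^+ k1 * x 1 ^+ k2 * x 2%:R ^+ k3.
have -> : \sum_(k < 'C(m + 2, 2)) bernstein k x =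
          \sum_(e <- bernstein_exponents m) F e.
  by rewrite (big_nth (0, 0, 0)%N) size_bernstein_exponents big_mkord.
rewrite /bernstein_exponents big_allpairs_dep.
(* [exprDn] gives the summation index as exponent to the second summand; with [x 0] last, the outer
   index is [k1]. *)
have -> : \sum_(i < 3) x i = (x 1 + x 2%:R) + x 0.
  rewrite !big_ord_recl big_ord0 addr0 addrC; congr (x _ + x _ + _).
    exact: val_inj.
  exact: val_inj.
rewrite exprDn -[iota 0 m.+1]/(index_iota 0 m.+1) big_mkord.
apply: eq_bigr => -[a /=]; rewrite ltnS => am _.
rewrite addrC exprDn -[0%N :: iota 1 _]/(index_iota 0 (m - a).+1) big_mkord.
rewrite big_distrl /= -sumrMnl; apply: eq_bigr => -[b /=]; rewrite ltnS => bm _.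
have fact_neq0 k : k`!%:R != 0 :> R by rewrite pnatr_eq0 -lt0n fact_gt0.
(* Unfolding [m!] and then [(m - a)!] shows that the trinomial coefficient is
   ['C(m, a) * 'C(m - a, b)]. *)
rewrite -(bin_fact am) -(bin_fact bm) !natrM.
by field; rewrite !fact_neq0.
Qed.

(** Upgrades identities known only at points of [0,1] to identities of polynomials. *)
Lemma poly_eq0_on_unit_interval (R : realType) (q : {poly R}) :
  (forall t, 0 <= t <= 1 -> q.[t] = 0) -> q = 0.
Proof.
move=> q0; apply/eqP/negPn/negP => /max_poly_roots.
(* The points 1, 1/2, 1/3, ... give [size q] distinct roots in [0,1], one more than the degree of a
   nonzero [q] allows. *)
move=> /(_ [seq i.+1%:R^-1 | i <- iota 0 (size q)]).
rewrite size_map size_iota ltnn => H; suff: false by []; apply: H.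
  apply/allP => _ /mapP[i _ ->]; apply/rootP/q0.
  by rewrite invr_ge0 ler0n invf_le1 ?ltr0n // ler1n.
rewrite map_inj_uniq ?iota_uniq// => i k /invr_inj /eqP.
by rewrite eqr_nat eqSS => /eqP.
Qed.

(** Only the last polynomial reaches the top degree, so its coefficient must vanish; induction
    removes the others. *)
Lemma graded_poly_free (F : idomainType) (L : nat) (P : 'I_L -> {poly F})
    (c : 'I_L -> F) :
  (forall i, size (P i) = i.+1) -> \sum_i c i *: P i = 0 ->
  forall i, c i = 0.
Proof.
elim: L P c => [|L IH] P c sP; first by move=> _ [].
rewrite big_ord_recr /= => sum0.
have cL0 : c ord_max = 0.
  move/(congr1 (fun q : {poly F} => q`_L)): (sum0).
  rewrite coefD coef_sum big1 ?add0r => [|i _]; last first.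
    by rewrite coefZ nth_default ?mulr0 ?sP /=.
  rewrite coefZ coef0 => /eqP; rewrite mulf_eq0 => /orP[/eqP//|].
  have -> : (P ord_max)`_L = lead_coef (P ord_max) by rewrite lead_coefE sP.
  by rewrite lead_coef_eq0 -size_poly_eq0 sP.
rewrite cL0 scale0r addr0 in sum0 *.
have c0 := IH _ _ (fun i => sP (widen_ord (leqnSn L) i)) sum0.
move=> i; have [iL|Li] := ltnP i L.
  by rewrite -(c0 (Ordinal iL)); congr c; apply: val_inj.
rewrite -cL0; congr c; apply: val_inj => /=.
by apply/eqP; rewrite eqn_leq Li -ltnS ltn_ord.
Qed.

Lemma maxnorm01C (R : realType) (c : R) : maxnorm01 c%:P = `|c|.
Proof.
rewrite /maxnorm01 -[RHS]sup1; congr sup.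
apply/seteqP; split => [_ [t _ <-]|_ ->]/=; first by rewrite hornerC.
by exists 0; rewrite ?hornerC//= in_itv /= lexx ler01.
Qed.

(** The degree makes [P ord0] constant and the norm makes it 1 or -1. A constant agrees at both
    endpoints, so either sign convention selects 1. *)
Lemma normalized_jacobi_basis0 (R : realType) (alpha beta : R) (L : nat)
    (P : 'I_L.+1 -> {poly R}) :
  normalized_jacobi_basis alpha beta P -> P ord0 = 1.
Proof.
move=> [sP _ nP pos].
have P0C : P ord0 = ((P ord0)`_0)%:P by apply: size1_polyC; rewrite sP.
have := nP ord0; rewrite P0C maxnorm01C => n1.
have c_gt0 : 0 < (P ord0)`_0.
  by case: pos => /(_ ord0); rewrite {1}P0C hornerC.
by rewrite -polyC1 -n1 gtr0_norm.
Qed.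

Theorem proposition1 (R : realType) (m n : nat) (p : 'I_3 -> {poly R})
    (p_deg : forall i, (size (p i) <= n.+1)%N)
    (p_bary : forall t : R, 0 <= t <= 1 -> \sum_(i < 3) (p i).[t] = 1)
    (alpha beta : R) (alpha_gt : -1 < alpha) (beta_gt : -1 < beta)
    (P : 'I_(m * n).+1 -> {poly R})
    (P_jacobi : normalized_jacobi_basis alpha beta P)
    (D : 'M[R]_((m * n).+1, 'C(m + 2, 2)))
    (D_def : forall (k : 'I_('C(m + 2, 2))) (t : R), 0 <= t <= 1 ->
       bernstein k (fun i => (p i).[t]) =
       \sum_(j < (m * n).+1) D j k * (P j).[t])
    (j : 'I_(m * n).+1) :
  \sum_(k < 'C(m + 2, 2)) D j k = if j == ord0 then 1 else 0.
Proof.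
pose c j := \sum_(k < 'C(m + 2, 2)) D j k.
have [sP _ _ _] := P_jacobi.
have P1 := normalized_jacobi_basis0 P_jacobi.
have sum1 : \sum_j c j *: P j = 1.
  apply/eqP; rewrite -subr_eq0; apply/eqP.
  apply: poly_eq0_on_unit_interval => t t01.
  rewrite hornerD hornerN hornerC horner_sum.
  under eq_bigr do rewrite hornerZ mulr_suml.
  rewrite exchange_big /=.
  under eq_bigr do rewrite -D_def//.
  by rewrite sum_bernstein p_bary// expr1n subrr.
(* Since 1 is [P ord0], subtracting it only lowers the coefficient at [ord0] by one. *)
have /(graded_poly_free sP)/(_ j)/eqP :
    \sum_i (c i - (i == ord0)%:R) *: P i = 0.
  under eq_bigr do rewrite scalerBl.
  rewrite sumrB sum1 big_ord_recl /= scale1r P1 big1 ?addr0 ?subrr// => i _.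
  by rewrite scale0r.
by rewrite subr_eq0 => /eqP; rewrite /c => ->; case: eqP.
Qed.
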